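(* The generator matrix $H$ of the $n$-priority ASEP on $\Lambda_L$ is related to the Perk–Schultz Hamiltonian $H^{PS}$ by the ground state transformation $$H^{PS}=\hat\pi^{-1/2}\,H\,\hat\pi^{1/2}$$ and satisfies, for all $0\le\alpha\le n$ in the first and all $1\le\alpha\le n$ in the second relation, the commutation relations $$[H,\hat N^\alpha]=0,\qquad [H,Y^\pm_\alpha]=0,$$ where $\hat N^\alpha=\sum_{k=L^-}^{L^+}\hat n^\alpha_k$ and $Y^\pm_\alpha=\sum_{k=L^-}^{L^+}Y^{\alpha,\pm}(k)$ with $$Y^{\alpha,+}(k)=q^{-\sum_{l=L^-}^{k-1}\hat n^\alpha_l}\,\sigma^{\alpha,+}_k\,q^{\sum_{l=k+1}^{L^+}\hat n^\alpha_l},\qquad Y^{\alpha,-}(k)=q^{\sum_{l=L^-}^{k-1}\hat n^{\alpha-1}_l}\,\sigma^{\alpha,-}_k\,q^{-\sum_{l=k+1}^{L^+}\hat n^{\alpha-1}_l}.$$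
   Context: Fix an integer $n\ge1$, reals $w>0$, $q\ge1$, integers $L^-,L^+$ with $L:=L^+-L^-+1\ge2$, and $\Lambda_L=\{L^-,\dots,L^+\}$. Matrices act on $(\mathbb C^{n+1})^{\otimes L}$ with basis $|\eta\rangle=|\eta_{L^-})\otimes\dots\otimes|\eta_{L^+})$, $\eta\in\{0,\dots,n\}^{\Lambda_L}$, where $|0),\dots,|n)$ is the canonical basis of $\mathbb C^{n+1}$ and $(\alpha|=|\alpha)^T$. Single-site matrices: $\sigma^{\alpha\beta}=|\alpha)(\beta|$, $\hat n^\alpha=|\alpha)(\alpha|$, $\sigma^{\alpha,+}=|\alpha-1)(\alpha|$, $\sigma^{\alpha,-}=|\alpha)(\alpha-1|$; for an $(n+1)\times(n+1)$ matrix $a$, $a_k$ denotes $a$ acting on tensor factor $k$ and the identity on all others. Generator matrix: $H=\sum_{k=L^-}^{L^+-1}h_{k,k+1}$ with $$h_{k,k+1}=-w\sum_{\alpha=1}^n\sum_{\beta=0}^{\alpha-1}\big(q\,\sigma^{\beta\alpha}_k\sigma^{\alpha\beta}_{k+1}+q^{-1}\sigma^{\alpha\beta}_k\sigma^{\beta\alpha}_{k+1}\big)+\hat w_{k,k+1},\quad \hat w_{k,k+1}=w\sum_{\alpha=1}^n\sum_{\beta=0}^{\alpha-1}\big(q\,\hat n^\alpha_k\hat n^\beta_{k+1}+q^{-1}\hat n^\beta_k\hat n^\alpha_{k+1}\big)$$ ($-H_{\eta'\eta}$ for $\eta'\ne\eta$ is the transition rate from $\eta$ to $\eta'$). Perk–Schultz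 Hamiltonian: $H^{PS}=\sum_{k=L^-}^{L^+-1}h^{PS}_{k,k+1}$ with $$h^{PS}_{k,k+1}=-w\sum_{\alpha=1}^n\sum_{\beta=0}^{\alpha-1}\big(\sigma^{\beta\alpha}_k\sigma^{\alpha\beta}_{k+1}+\sigma^{\alpha\beta}_k\sigma^{\beta\alpha}_{k+1}\big)+\hat w_{k,k+1}.$$ $\hat\pi$ is the diagonal matrix with entries $\pi(\eta)=q^{\sum_{k}\sum_{l<k}\operatorname{sgn}(\eta_k-\eta_l)}$, and $\hat\pi^{\pm1/2}$ its positive powers entrywise on the diagonal. $[A,B]=AB-BA$. (The matrices $\hat N^\alpha$, $Y^\pm_\alpha$ are the representation matrices of the quantum algebra $U_q[\mathfrak{gl}(n+1)]$ used in the paper.) *)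

(* Defs.v *)
From HB Require Import structures.
From mathcomp Require Import all_boot all_order all_algebra.
From mathcomp Require Import complex.
From mathcomp Require Import reals exp.

Set Implicit Arguments.
Unset Strict Implicit.
Unset Printing Implicit Defensive.

Import Order.TTheory GRing.Theory Num.Theory.
Local Open Scope ring_scope.
Local Open Scope complex_scope.

(* The integers Lm, ..., Lp, provided Lm <= Lp + 1. *)
Definition lattice (Lm Lp : int) : seq int :=
  [seq Lm + i%:Z | i <- iota 0 (absz (Lp - Lm + 1))].

(* A site k has position \val k : int. *)
Notation site Lm Lp := (seq_sub (lattice Lm Lp)).

Notation config n Lm Lp := {ffun site Lm Lp -> 'I_n.+1}.

(* Endomorphisms of (C^(n+1))^{(x) L}, in the basis |eta>: row and column i
   correspond to the configuration enum_val i. *)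
Notation op R n Lm Lp := 'M[R[i]]_#|{: config n Lm Lp}|.

Section PriorityASEP.
Variables (R : realType) (n : nat) (Lm Lp : int).

Local Notation C := (R[i]).
Local Notation site := (site Lm Lp).
Local Notation config := (config n Lm Lp).
Local Notation op := (op R n Lm Lp).

(* The tensor product of the matrices A k, over all sites k. *)
Definition tens (A : site -> 'M[C]_n.+1) : op :=
  \matrix_(i, j) \prod_(k : site)
    A k ((enum_val i : config) k) ((enum_val j : config) k).

Definition at_site (a : 'M[C]_n.+1) (k : site) : op :=
  tens (fun l => if l == k then a else 1%:M).

Definition sigma (a b : 'I_n.+1) : 'M[C]_n.+1 := delta_mx a b.

Definition n_hat (a : 'I_n.+1) : 'M[C]_n.+1 := delta_mx a a.

(* sigma_up and sigma_down are only meant for 0 < a, in which case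
   inord a.-1 is a - 1. *)
Definition sigma_up (a : 'I_n.+1) : 'M[C]_n.+1 := sigma (inord a.-1) a.

Definition sigma_down (a : 'I_n.+1) : 'M[C]_n.+1 := sigma a (inord a.-1).

(* c^D and D^s for a real diagonal matrix D (with positive diagonal for D^s),
   and a positive real c. *)
Definition pow_diag (c : R) (D : op) : op :=
  diag_mx (\row_i (c `^ complex.Re (D i i))%:C).

Definition diag_pow (D : op) (s : R) : op :=
  diag_mx (\row_i (complex.Re (D i i) `^ s)%:C).

Definition commutator (A B : op) : op := A *m B - B *m A.

Variables (w q : R).

Definition w_hat (k l : site) : op :=
  w%:C *: \sum_(a < n.+1) \sum_(b < n.+1 | (b < a)%N)
    (q%:C *: (at_site (n_hat a) k *m at_site (n_hat b) l)
     + q%:C^-1 *: (at_site (n_hat b) k *m at_site (n_hat a) l)).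

Definition h_ASEP (k l : site) : op :=
  - (w%:C *: \sum_(a < n.+1) \sum_(b < n.+1 | (b < a)%N)
      (q%:C *: (at_site (sigma b a) k *m at_site (sigma a b) l)
       + q%:C^-1 *: (at_site (sigma a b) k *m at_site (sigma b a) l)))
  + w_hat k l.

Definition h_PS (k l : site) : op :=
  - (w%:C *: \sum_(a < n.+1) \sum_(b < n.+1 | (b < a)%N)
      (at_site (sigma b a) k *m at_site (sigma a b) l
       + at_site (sigma a b) k *m at_site (sigma b a) l))
  + w_hat k l.

(* In both sums, k = Lp has no right neighbour l and contributes nothing. *)
Definition H_ASEP : op :=
  \sum_(k : site) \sum_(l : site | \val l == \val k + 1) h_ASEP k l.

Definition H_PS : op :=
  \sum_(k : site) \sum_(l : site | \val l == \val k + 1) h_PS k l.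

Definition pi_weight (eta : config) : R :=
  q ^ (\sum_(k : site) \sum_(l : site | (\val l < \val k)%R)
         sgz ((eta k)%:Z - (eta l)%:Z)).

Definition pi_hat : op :=
  diag_mx (\row_i (pi_weight (enum_val i : config))%:C).

Definition N_hat (a : 'I_n.+1) : op := \sum_(k : site) at_site (n_hat a) k.

Definition N_left (a : 'I_n.+1) (k : site) : op :=
  \sum_(l : site | (\val l < \val k)%R) at_site (n_hat a) l.

Definition N_right (a : 'I_n.+1) (k : site) : op :=
  \sum_(l : site | (\val k < \val l)%R) at_site (n_hat a) l.

Definition Y_plus_at (a : 'I_n.+1) (k : site) : op :=
  pow_diag q (- N_left a k) *m at_site (sigma_up a) k
    *m pow_diag q (N_right a k).

Definition Y_minus_at (a : 'I_n.+1) (k : site) : op :=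
  pow_diag q (N_left (inord a.-1) k) *m at_site (sigma_down a) k
    *m pow_diag q (- N_right (inord a.-1) k).

Definition Y_plus (a : 'I_n.+1) : op := \sum_(k : site) Y_plus_at a k.

Definition Y_minus (a : 'I_n.+1) : op := \sum_(k : site) Y_minus_at a k.

End PriorityASEP.

(* Main.v *)
(** Rows act on functions: H sends f to
    xi |-> sum over bonds (k, l) of w r(xi_k, xi_l) (f xi - f (xi with k, l
    exchanged)), where r(x, y) is q, q^-1 or 0 according to x > y, x < y or
    x = y.  Exchanging xi_k and xi_l on a bond adds 2 sgn(xi_k - xi_l) to the
    exponent of pi, and the square root of this ratio cancels r, which gives
    the ground state transformation.  Both Y^+ and Y^- have the form
    xi |-> sum_m Q^(e_m xi) [xi_m = s] f (xi with xi_m := t), where s, t are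
    neighbouring colours, Q is q or q^-1, and e_m counts the s to the right
    of m minus the s to its left.  H commutes with this sum bond by bond: for m
    off the bond because e_m is invariant under the exchange, for m on the
    bond by a two-site case check. *)
Require Import Defs.
From HB Require Import structures.
From mathcomp Require Import all_boot all_order all_algebra.
From mathcomp Require Import complex.
From mathcomp Require Import reals exp.
From mathcomp Require Import perm zify ring.

Set Implicit Arguments.
Unset Strict Implicit.
Unset Printing Implicit Defensive.

Import Order.TTheory GRing.Theory Num.Theory.
Local Open Scope ring_scope.
Local Open Scope complex_scope.

(** * Matrices acting on functions as on row vectors *)

Section RowAction.
Variables (K : comNzRingType) (T : finType).
Implicit Types (A B : 'M[K]_#|T|) (f g : T -> K) (x : T).

(** [f] is a row vector multiplied by [A] from the right, so in a product the left factor acts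
    first. The column index [x] is the state that a transition leaves: H acts as minus a backward
    Markov generator. *)
Definition act A f x : K := \sum_y f y * A (enum_rank y) (enum_rank x).

Lemma act_mulmx A B f x : act (A *m B) f x = act B (act A f) x.
Proof.
rewrite /act; under eq_bigr => y _ do rewrite mxE mulr_sumr.
rewrite exchange_big /= (reindex_onto enum_rank enum_val) /=; last first.
  by move=> i _; rewrite enum_valK.
apply: eq_big => [y|y _]; first by rewrite enum_rankK eqxx.
by rewrite mulr_suml; apply: eq_bigr => z _; rewrite mulrA.
Qed.

Lemma act_inj A B : (forall f x, act A f x = act B f x) -> A = B.
Proof.
move=> AB; apply/matrixP => i j.
rewrite -(enum_valK i) -(enum_valK j); move: (enum_val i) (enum_val j) => y x.
have actE C : act C (fun z => (z == y)%:R) x = C (enum_rank y) (enum_rank x).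
  rewrite /act (bigD1 y) //= eqxx mul1r big1 ?addr0 // => z /negPf->.
  by rewrite mul0r.
by rewrite -!actE.
Qed.

Lemma actD A B f x : act (A + B) f x = act A f x + act B f x.
Proof.
by rewrite -big_split; apply: eq_bigr => y _; rewrite mxE mulrDr.
Qed.

Lemma actN A f x : act (- A) f x = - act A f x.
Proof. by rewrite -sumrN; apply: eq_bigr => y _; rewrite mxE mulrN. Qed.

Lemma actZ c A f x : act (c *: A) f x = c * act A f x.
Proof.
by rewrite mulr_sumr; apply: eq_bigr => y _; rewrite mxE mulrCA.
Qed.

Lemma act_sum (I : finType) (P : pred I) (F : I -> 'M[K]_#|T|) f x :
  act (\sum_(i | P i) F i) f x = \sum_(i | P i) act (F i) f x.
Proof.
rewrite /act exchange_big; apply: eq_bigr => y _ /=.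
by rewrite summxE mulr_sumr.
Qed.

Lemma act_diag (d : 'rV[K]_#|T|) f x :
  act (diag_mx d) f x = d 0 (enum_rank x) * f x.
Proof.
rewrite /act (bigD1 x) //= mxE eqxx mulr1n mulrC big1 ?addr0 // => y yx.
by rewrite mxE (inj_eq enum_rank_inj) (negPf yx) mulr0n mulr0.
Qed.

End RowAction.

(** * Scalar identities for a single bond *)

Lemma sum_ltn_indicator (K : comNzRingType) (m : nat) (c d : K) (x y : 'I_m)
    (F : 'I_m -> 'I_m -> K) :
  \sum_(a < m) \sum_(b < m | (b < a)%N)
    (c * ((y == b)%:R * ((x == a)%:R * F a b))
     + d * ((y == a)%:R * ((x == b)%:R * F b a))) =
  (if (y < x)%N then c else if (x < y)%N then d else 0) * F x y.
Proof.
(* Only the pair [(a, b) = (u, v)] survives, and it is in range exactly when [v < u]. The two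
   families of terms are hit at [(x, y)] and [(y, x)], hence at most one of them contributes. *)
have sum1 (G : 'I_m -> 'I_m -> K) (u v : 'I_m) :
    \sum_(a < m) \sum_(b < m | (b < a)%N) ((v == b)%:R * ((u == a)%:R * G a b))
    = (v < u)%N%:R * G u v.
  rewrite (bigD1 u) //= [X in _ + X]big1 ?addr0 => [|a au]; last first.
    by apply: big1 => b _; rewrite [u == a]eq_sym (negPf au) mul0r mulr0.
  rewrite big_mkcond (bigD1 v) //= [X in _ + X]big1 ?addr0 => [|b bv]; last first.
    by rewrite [v == b]eq_sym (negPf bv) mul0r if_same.
  by rewrite !eqxx !mul1r; case: ifP; rewrite ?mul1r ?mul0r.
under eq_bigr => a _.
  under eq_bigr => b _ do rewrite [(y == a)%:R * _]mulrCA.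
  rewrite big_split -!mulr_sumr; over.
rewrite big_split -!mulr_sumr /= sum1 (sum1 (fun a b => F b a)).
by case: ltngtP => _; rewrite /= ?mul1r ?mul0r ?mulr0 ?addr0 ?add0r.
Qed.

(* The two-site check; x and y say whether the left and the right site of the
   bond carry the colour s, F and G collect the sites off the bond. *)
Lemma bond_algebra (K : fieldType) (c Q r r1 r2 A B A' B' F G : K) (x y : bool) :
    (x -> y -> [/\ r = 0, Q * r1 = Q^-1 * r2, A' = A & B' = B]) ->
    (x -> ~~ y -> r1 * (A - B') = r * (A - B')) ->
    (~~ x -> y -> r2 * (B - A') = r * (B - A')) ->
  r * (c * Q ^ y%:Z * (x%:R * A) + (c * Q ^ (- x%:Z) * (y%:R * B) + F)
       - (c * Q ^ x%:Z * (y%:R * A') + (c * Q ^ (- y%:Z) * (x%:R * B') + G)))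
  = c * Q ^ y%:Z * (x%:R * (r1 * (A - B')))
    + (c * Q ^ (- x%:Z) * (y%:R * (r2 * (B - A'))) + r * (F - G)).
Proof.
case: x; case: y => xy xNy Nxy; rewrite ?(expr0z, oppr0) ?expr1z ?exprN1 /=.
- have [-> Qr -> ->] := xy isT isT.
  (* Both sites carry s: the left side vanishes because [r = 0], the right side because its two
     terms balance by [Qr]. *)
  by transitivity (c * (Q * r1 - Q^-1 * r2) * (A - B)); [rewrite Qr|]; ring.
- by rewrite xNy //; ring.
- by rewrite Nxy //; ring.
- by ring.
Qed.

(** * Updates and exchanges of configurations *)

Section Configurations.
Variables (S X : finType).
Implicit Types (xi eta : {ffun S -> X}) (k l : S).

Definition upd k (x : X) xi : {ffun S -> X} :=
  [ffun i => if i == k then x else xi i].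

Definition swap k l xi : {ffun S -> X} := [ffun i => xi (tperm k l i)].

Lemma upd_upd k l x y xi : xi k = x -> xi l = y -> upd k x (upd l y xi) = xi.
Proof.
by move=> <- <-; apply/ffunP=> i; rewrite !ffunE;
  case: eqP => [->|] //; case: eqP => [->|].
Qed.

Lemma upd_swap k l xi : upd k (xi l) (upd l (xi k) xi) = swap k l xi.
Proof.
apply/ffunP=> i; rewrite !ffunE.
by case: tpermP => [->|->|/eqP/negPf-> /eqP/negPf->] //; rewrite eqxx //;
  case: eqP => [->|].
Qed.

Lemma swapC k l xi : swap k l xi = swap l k xi.
Proof. by apply/ffunP=> i; rewrite !ffunE tpermC. Qed.

Lemma swap_upd k l m x xi : m != k -> m != l ->
  swap k l (upd m x xi) = upd m x (swap k l xi).
Proof.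
move=> mk ml; apply/ffunP=> i; rewrite !ffunE.
by rewrite -{1}(@tpermD _ k l m) ?(inj_eq (@perm_inj _ (tperm k l))) // eq_sym.
Qed.

Lemma swap_updl k l x xi : swap k l (upd k x xi) = upd l x (swap k l xi).
Proof.
apply/ffunP=> i; rewrite !ffunE.
by rewrite -[X in _ == X](tpermR k l) (inj_eq (@perm_inj _ (tperm k l))).
Qed.

Lemma swap_updr k l x xi : swap k l (upd l x xi) = upd k x (swap k l xi).
Proof. by rewrite swapC swap_updl swapC. Qed.

(** Both configurations carry [x] on [k] and on [l]. In the ladder sums this occurs when the target
    colour already sits on the other site of the bond. *)
Lemma upd_swapr k l x xi : xi l = x -> upd l x (swap k l xi) = upd k x xi.
Proof.
by move=> <-; rewrite -upd_swap; apply/ffunP=> i; rewrite !ffunE;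
  case: (eqVneq i l) => [->|_]; case: eqP => // ->.
Qed.

Lemma upd_swapl k l x xi : xi k = x -> upd k x (swap k l xi) = upd l x xi.
Proof. by rewrite swapC => /upd_swapr. Qed.

End Configurations.

(** * Row actions of the local operators and of the two Hamiltonians *)

Section Lattice.
Variables (R : realType) (n : nat) (Lm Lp : int).

Local Notation C := (R[i]).
Local Notation site := (site Lm Lp).
Local Notation config := (config n Lm Lp).
Implicit Types (k l m : site) (a b s t : 'I_n.+1) (xi eta : config) (f : config -> C).

Lemma at_sigmaE a b k eta xi :
  at_site (sigma R a b) k (enum_rank eta) (enum_rank xi)
  = (xi k == b)%:R * (eta == upd k a xi)%:R.
Proof.
rewrite mxE !enum_rankK (bigD1 k) //= eqxx mxE.
have [->|eta_xi] := eqVneq eta (upd k a xi).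
  rewrite !ffunE !eqxx /= big1 ?mulr1 // => l /negPf lk.
  by rewrite lk mxE ffunE lk eqxx.
rewrite mulr0; have [etak|] := eqVneq (eta k) a; last by rewrite mul0r.
(* At a site off [k] where the configurations differ, the identity factor has a zero entry. *)
suff /existsP[l /andP[lk ne]] : [exists l, (l != k) && (eta l != xi l)].
  by rewrite (bigD1 l) //= (negPf lk) mxE (negPf ne) mul0r mulr0.
apply: contraR eta_xi => /existsPn eq; apply/eqP/ffunP => l; rewrite ffunE.
by case: eqVneq => [->//|lk]; move: (eq l); rewrite lk negbK => /eqP.
Qed.

Lemma act_sigma a b k f xi :
  act (at_site (sigma R a b) k) f xi = (xi k == b)%:R * f (upd k a xi).
Proof.
rewrite /act (bigD1 (upd k a xi)) //= at_sigmaE eqxx mulr1 mulrC.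
by rewrite big1 ?addr0 // => eta /negPf ne; rewrite at_sigmaE ne !mulr0.
Qed.

Lemma act_sigma2 a b s t k l f xi : k != l ->
  act (at_site (sigma R a b) k *m at_site (sigma R s t) l) f xi
  = (xi l == t)%:R * ((xi k == b)%:R * f (upd k a (upd l s xi))).
Proof. by move=> kl; rewrite act_mulmx !act_sigma ffunE (negPf kl). Qed.

Variables (w q : R).

Definition jump_rate (x y : 'I_n.+1) : C :=
  if (y < x)%N then q%:C else if (x < y)%N then q%:C^-1 else 0.

Lemma act_w_hat k l f xi : k != l ->
  act (w_hat n w q k l) f xi = w%:C * (jump_rate (xi k) (xi l) * f xi).
Proof.
move=> kl; rewrite actZ act_sum; congr (_ * _).
(* Updating [xi] with its own values gives the diagonal terms the shape of hopping terms. *)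
rewrite -[X in f X](@upd_upd _ _ k l (xi k) (xi l) xi) //.
apply: etrans (sum_ltn_indicator _ _ (xi k) (xi l)
  (fun a b => f (upd k a (upd l b xi)))).
apply: eq_bigr => a _; rewrite act_sum; apply: eq_bigr => b _.
by rewrite actD !actZ !act_sigma2.
Qed.

Lemma act_hop (c d : C) k l f xi : k != l ->
  act (\sum_(a < n.+1) \sum_(b < n.+1 | (b < a)%N)
        (c *: (at_site (sigma R b a) k *m at_site (sigma R a b) l)
         + d *: (at_site (sigma R a b) k *m at_site (sigma R b a) l))) f xi
  = (if (xi l < xi k)%N then c else if (xi k < xi l)%N then d else 0)
    * f (swap k l xi).
Proof.
move=> kl; rewrite act_sum -upd_swap.
apply: etrans (sum_ltn_indicator _ _ (xi k) (xi l)
  (fun a b => f (upd k b (upd l a xi)))).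
apply: eq_bigr => a _; rewrite act_sum; apply: eq_bigr => b _.
by rewrite actD !actZ !act_sigma2.
Qed.

(** The diagonal part and the hopping part carry the same rate, so they combine into a difference of
    values of [f]. *)
Lemma act_h_ASEP k l f xi : k != l ->
  act (h_ASEP n w q k l) f xi
  = w%:C * (jump_rate (xi k) (xi l) * (f xi - f (swap k l xi))).
Proof.
move=> kl; rewrite /h_ASEP; have := act_w_hat f xi kl.
move: (w_hat n w q k l) => W WE; rewrite actD actN actZ act_hop // WE.
by rewrite addrC -!mulrBr.
Qed.

Lemma act_h_PS k l f xi : k != l ->
  act (h_PS n w q k l) f xi
  = w%:C * (jump_rate (xi k) (xi l) * f xi
            - (xi k != xi l)%:R * f (swap k l xi)).
Proof.
move=> kl; rewrite actD actN actZ act_w_hat //.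
(* Explicit unit coefficients make the Perk-Schultz hopping the case [c = d = 1] of [act_hop]. *)
under eq_bigr => a _ do
  under eq_bigr => b _ do rewrite -[X in X + _]scale1r -[X in _ + X]scale1r.
rewrite act_hop // /jump_rate -val_eqE /=.
by case: ltngtP => _ /=; ring.
Qed.

Lemma adjacent_neq k l : \val l == \val k + 1 -> k != l.
Proof. by move=> kl; apply/eqP => e; move: kl; rewrite e; lia. Qed.

Lemma act_H_ASEP f xi :
  act (H_ASEP n Lm Lp w q) f xi = \sum_k \sum_(l : site | \val l == \val k + 1)
    w%:C * (jump_rate (xi k) (xi l) * (f xi - f (swap k l xi))).
Proof.
rewrite act_sum; apply: eq_bigr => k _; rewrite act_sum.
by apply: eq_bigr => l /adjacent_neq kl; rewrite act_h_ASEP.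
Qed.

Lemma act_H_PS f xi :
  act (H_PS n Lm Lp w q) f xi = \sum_k \sum_(l : site | \val l == \val k + 1)
    w%:C * (jump_rate (xi k) (xi l) * f xi
            - (xi k != xi l)%:R * f (swap k l xi)).
Proof.
rewrite act_sum; apply: eq_bigr => k _; rewrite act_sum.
by apply: eq_bigr => l /adjacent_neq kl; rewrite act_h_PS.
Qed.

Lemma act_diag_pow (D : op R n Lm Lp) (e : R) f xi :
  act (diag_pow D e) f xi
  = (complex.Re (D (enum_rank xi) (enum_rank xi)) `^ e)%:C * f xi.
Proof. by rewrite act_diag mxE. Qed.

Lemma act_pow_diag (c : R) (D : op R n Lm Lp) f xi :
  act (pow_diag c D) f xi
  = (c `^ complex.Re (D (enum_rank xi) (enum_rank xi)))%:C * f xi.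
Proof. by rewrite act_diag mxE. Qed.

Lemma act_sum_n_hat a (P : pred site) f xi :
  act (\sum_(k | P k) at_site (n_hat R a) k) f xi
  = (\sum_(k | P k) (xi k == a))%:R * f xi.
Proof.
rewrite act_sum natr_sum mulr_suml; apply: eq_bigr => k _.
rewrite act_sigma; case: eqP => [<-|_]; last by rewrite !mul0r.
by congr (_ * f _); apply/ffunP => l; rewrite ffunE; case: eqP => [->|].
Qed.

Lemma sum_n_hat_diagE a (P : pred site) xi :
  (\sum_(k | P k) at_site (n_hat R a) k) (enum_rank xi) (enum_rank xi)
  = (\sum_(k | P k) (xi k == a))%:R.
Proof.
rewrite summxE natr_sum; apply: eq_bigr => k _.
rewrite at_sigmaE; case: eqP => [<-|_]; last by rewrite mul0r.
suff -> : upd k (xi k) xi = xi by rewrite eqxx mulr1.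
by apply/ffunP => l; rewrite ffunE; case: eqP => [->|].
Qed.

(** * Commutators and conservation of the colour numbers *)

Lemma commutator_eq0 (A B : op R n Lm Lp) :
  (forall f xi, act A (act B f) xi = act B (act A f) xi) -> commutator A B = 0.
Proof.
move=> AB; apply/eqP; rewrite subr_eq0; apply/eqP/act_inj => f xi.
by rewrite !act_mulmx AB.
Qed.

(** An exchange permutes the sites and so preserves the number of sites of colour [a];
    multiplication by this number passes through every bond term. *)
Lemma commutator_H_N_hat a :
  commutator (H_ASEP n Lm Lp w q) (N_hat R Lm Lp a) = 0.
Proof.
apply: commutator_eq0 => f xi.
rewrite act_sum_n_hat !act_H_ASEP mulr_sumr; apply: eq_bigr => k _.
rewrite mulr_sumr; apply: eq_bigr => l _; rewrite !act_sum_n_hat.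
have -> : (\sum_i (swap k l xi i == a) = \sum_i (xi i == a))%N.
  rewrite [RHS](reindex_perm (tperm k l)) /=.
  by apply: eq_bigr => i _; rewrite ffunE.
ring.
Qed.

(** * The exponent of pi and the ground state transformation *)

Lemma tperm_adjacent_lt k l i j : \val l == \val k + 1 ->
  (\val (tperm k l j) < \val (tperm k l i))%R%:Z
  = (\val j < \val i)%R%:Z
    + (i == k)%:Z * (j == l)%:Z - (i == l)%:Z * (j == k)%:Z.
Proof.
pose pos (x : site) : int := \val x.
have pos_inj (x y : site) : x != y -> pos x <> pos y by move=> /eqP + /val_inj.
have ltE (x y : site) : (\val x < \val y)%R = (pos x < pos y)%R by [].
move=> /eqP kl; rewrite !ltE; have {}kl : pos l = pos k + 1 := kl.
have lk : l != k by apply/eqP => e; move: kl; rewrite e; lia.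
(* No position lies strictly between [k] and [l], so a site off the bond compares alike with both;
   only the order of the pair itself is reversed, which the products of indicators record. *)
case: (tpermP k l i) => [->|->|/eqP ik /eqP il];
  case: (tpermP k l j) => [->|->|/eqP jk /eqP jl];
  rewrite ?eqxx ?(eq_sym k l) ?(negPf lk) ?(negPf ik) ?(negPf il);
  rewrite ?(negPf jk) ?(negPf jl) /=; move/pos_inj: lk => lk;
  try (move/pos_inj: ik => ik; move/pos_inj: il => il);
  try (move/pos_inj: jk => jk; move/pos_inj: jl => jl);
  lia.
Qed.

(** The exponent of [q] in [pi_weight]. *)
Definition energy (xi : config) : int :=
  \sum_(k : site) \sum_(l : site | (\val l < \val k)%R)
    sgz ((xi k)%:Z - (xi l)%:Z).

Lemma energyE xi : energy xi =
  \sum_i \sum_j (\val j < \val i)%R%:Z * sgz ((xi i)%:Z - (xi j)%:Z).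
Proof.
apply: eq_bigr => i _; rewrite big_mkcond; apply: eq_bigr => j _.
by case: ifP; rewrite ?mul1r ?mul0r.
Qed.

(** Only the pair on the bond changes its relative order: its contribution sgn(xi_l - xi_k) becomes
    sgn(xi_k - xi_l). *)
Lemma energy_swap k l xi : \val l == \val k + 1 ->
  energy (swap k l xi) = energy xi + 2 * sgz ((xi k)%:Z - (xi l)%:Z).
Proof.
move=> kl; pose S i j := sgz ((xi i)%:Z - (xi j)%:Z).
have SC i j : S i j = - S j i by rewrite /S -sgzN opprB.
have sumS i j : \sum_x \sum_y (x == i)%:Z * (y == j)%:Z * S x y = S i j.
  rewrite (bigD1 i) //= [X in _ + X]big1 ?addr0 => [|x /negPf xi']; last first.
    by apply: big1 => y _; rewrite xi' !mul0r.
  rewrite (bigD1 j) //= [X in _ + X]big1 ?addr0 => [|y /negPf yj].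
    by rewrite !eqxx !mul1r.
  by rewrite yj mulr0 mul0r.
rewrite !energyE (reindex_perm (tperm k l)) /=.
under eq_bigr => i _ do rewrite (reindex_perm (tperm k l)) /=.
(* Relabelling both indices by the transposition restores the colours of [xi] and moves the change
   into the comparison of positions. *)
transitivity (\sum_i \sum_j ((\val j < \val i)%R%:Z * S i j
   + (i == k)%:Z * (j == l)%:Z * S i j - (i == l)%:Z * (j == k)%:Z * S i j)).
  apply: eq_bigr => i _; apply: eq_bigr => j _.
  by rewrite tperm_adjacent_lt // !ffunE !tpermK -mulrDl -mulrBl.
under [LHS]eq_bigr => i _ do rewrite sumrB big_split /=.
rewrite sumrB big_split /= !sumS (SC l k) -/(S k l); ring.
Qed.

Lemma ground_state_transformation : 0 < q ->
  H_PS n Lm Lp w q = diag_pow (pi_hat n Lm Lp q) (- 2^-1)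
    *m H_ASEP n Lm Lp w q *m diag_pow (pi_hat n Lm Lp q) 2^-1.
Proof.
move=> q0; apply: act_inj => f xi; rewrite act_mulmx act_diag_pow act_mulmx.
rewrite act_H_PS act_H_ASEP mulr_sumr; apply: eq_bigr => k _.
rewrite mulr_sumr; apply: eq_bigr => l kl; rewrite !act_diag_pow.
have piE eta e : complex.Re
    (pi_hat n Lm Lp q (enum_rank eta) (enum_rank eta)) `^ e
    = q `^ ((energy eta)%:~R * e).
  by rewrite !mxE eqxx mulr1n enum_rankK /= -[pi_weight q eta]/(q ^ energy eta)
    -powR_intmul ?ltW // -powRrM.
rewrite !piE [RHS]mulrCA; congr (_ * _).
have pp e1 e2 : (q `^ e1)%:C * (q `^ e2)%:C = (q `^ (e1 + e2))%:C.
  by rewrite -rmorphM /= powRD // (gt_eqF q0) implybT.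
have -> (r a b c g h : C) : c * (r * (a * g - b * h)) = r * (c * a) * g - r * (c * b) * h.
  ring.
(* On the diagonal the two powers of pi cancel. The hopping term keeps half the energy difference,
   -sgn(xi_k - xi_l), as its exponent. *)
rewrite !pp mulrN addrN powRr0 mulr1; congr (_ - _ * _).
rewrite energy_swap // /jump_rate.
have -> : (energy xi)%:~R / 2
    + (energy xi + 2 * sgz ((xi k)%:Z - (xi l)%:Z))%:~R * - 2^-1
    = - (sgz ((xi k)%:Z - (xi l)%:Z))%:~R :> R.
  by rewrite intrD intrM; field.
(* The remaining factor is q q^-1, q^-1 q or 0, that is, the indicator of distinct colours. *)
rewrite -val_eqE /=; case: ltngtP => [lk|kl'|_]; last by rewrite mul0r.
  rewrite gtr0_sgz ?subr_gt0 // powR_inv1 ?ltW // fmorphV.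
  by rewrite mulfV // fmorph_eq0 gt_eqF.
rewrite ltr0_sgz ?subr_lt0 // mulrN1z opprK powRr1 ?ltW //.
by rewrite mulVf // fmorph_eq0 gt_eqF.
Qed.

(** * The excess of a colour to the right of a site, and its behaviour under exchanges *)

Definition excess s m xi : int :=
  \sum_j sgz (\val j - \val m) * (xi j == s)%:Z.

Lemma excessE s m xi : excess s m xi =
  (\sum_(l : site | (\val m < \val l)%R) (xi l == s))%N%:Z
  - (\sum_(l : site | (\val l < \val m)%R) (xi l == s))%N%:Z.
Proof.
rewrite !(big_morph Posz PoszD (erefl 0%:Z)).
rewrite [X in X - _]big_mkcond [X in _ - X]big_mkcond -sumrB.
apply: eq_bigr => j _; case: (ltrgtP (\val m) (\val j)) => [lt|lt|->].
- by rewrite gtr0_sgz ?subr_gt0 // mul1r subr0.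
- by rewrite ltr0_sgz ?subr_lt0 // mulN1r sub0r.
- by rewrite subr0 subrr sgz0 mul0r.
Qed.

(** A site off the bond cannot lie between two consecutive positions, so it sees both of them on the
    same side. *)
Lemma sgz_sub_adjacent k l m : \val l == \val k + 1 -> m != k -> m != l ->
  sgz (\val m - \val l) = sgz (\val m - \val k).
Proof.
pose pos (x : site) : int := \val x.
have pos_inj (x y : site) : x != y -> pos x <> pos y by move=> /eqP + /val_inj.
move=> /eqP kl /pos_inj mk /pos_inj ml.
rewrite -/(pos m) -/(pos k) -/(pos l); have {}kl : pos l = pos k + 1 := kl.
have [lt|gt|//] := ltrgtP (pos m) (pos k).
  by rewrite !ltr0_sgz; lia.
by rewrite !gtr0_sgz; lia.
Qed.

Lemma excess_swap s k l m xi : \val l == \val k + 1 -> m != k -> m != l ->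
  excess s m (swap k l xi) = excess s m xi.
Proof.
move=> kl mk ml; rewrite /excess (reindex_perm (tperm k l)) /=.
apply: eq_bigr => j _; rewrite ffunE tpermK; congr (_ * _).
by case: (tpermP k l j) => // ->;
  rewrite -!(opprB (\val m)) !sgzN (sgz_sub_adjacent kl).
Qed.

(** The part of the excess shared by both sites of the bond; it supplies the common factor [c] of
    [bond_algebra]. Signs relative to [k] suffice, since off the bond they agree with those relative
    to [l]. *)
Definition bulk_excess s k l xi : int :=
  \sum_(j | (j != k) && (j != l)) sgz (\val j - \val k) * (xi j == s)%:Z.

Lemma excess_left s k l xi : \val l == \val k + 1 ->
  excess s k xi = bulk_excess s k l xi + (xi l == s)%:Z.
Proof.
move=> kl; have lk : l != k by rewrite eq_sym adjacent_neq.
rewrite /excess (bigD1 k) //= subrr sgz0 mul0r add0r (bigD1 l) //= addrC.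
by rewrite (eqP kl) [_ - _]addrAC subrr add0r mul1r.
Qed.

Lemma excess_right s k l xi : \val l == \val k + 1 ->
  excess s l xi = bulk_excess s k l xi - (xi k == s)%:Z.
Proof.
move=> kl.
rewrite /excess (bigD1 l) //= subrr sgz0 mul0r add0r.
rewrite (bigD1 k (adjacent_neq kl)) /= addrC.
have -> : \val k - \val l = -1 by rewrite (eqP kl) opprD addrA subrr sub0r.
rewrite mulN1r; congr (_ + _).
apply: eq_big => [j|j /andP[jl jk]]; first exact: andbC.
by rewrite (sgz_sub_adjacent kl).
Qed.

Lemma bulk_excess_swap s k l xi : \val l == \val k + 1 ->
  bulk_excess s k l (swap k l xi) = bulk_excess s k l xi.
Proof.
move=> kl; apply: eq_bigr => j /andP[jk jl].
by rewrite ffunE tpermD // eq_sym.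
Qed.

(** * Ladder sums and their commutation with H, bond by bond *)

Definition ladder (Q : C) s t f xi : C :=
  \sum_m Q ^ excess s m xi * ((xi m == s)%:R * f (upd m t xi)).

(** No colour lies strictly between a - 1 and a, so a third colour compares alike with both. The two
    equations are paired to serve as one rewrite rule. *)
Lemma jump_rate_pred a x : (0 < a)%N -> x != a -> x != inord a.-1 ->
  (jump_rate (inord a.-1) x = jump_rate a x)
  * (jump_rate x (inord a.-1) = jump_rate x a).
Proof.
move=> a0; rewrite -!val_eqE /jump_rate /=.
have -> : (inord a.-1 : 'I_n.+1) = a.-1 :> nat.
  by rewrite inordK // (leq_ltn_trans (leq_pred a)).
move=> xa xb.
have lt1 : (x < a.-1)%N = (x < a)%N by lia.
have lt2 : (a.-1 < x)%N = (a < x)%N by lia.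
by rewrite lt1 lt2.
Qed.

Lemma ladder_bond (Q : C) s t k l f xi : Q != 0 ->
    (forall x, x != s -> x != t ->
      (jump_rate t x = jump_rate s x) * (jump_rate x t = jump_rate x s)) ->
    Q * jump_rate t s = Q^-1 * jump_rate s t -> \val l == \val k + 1 ->
  jump_rate (xi k) (xi l)
    * (ladder Q s t f xi - ladder Q s t f (swap k l xi))
  = \sum_m Q ^ excess s m xi * ((xi m == s)%:R
      * (jump_rate (upd m t xi k) (upd m t xi l)
         * (f (upd m t xi) - f (swap k l (upd m t xi))))).
Proof.
move=> Q0 rst Qr kl; have neq_kl := adjacent_neq kl.
have lk : l != k by rewrite eq_sym.
(* The terms [m = k] and [m = l] are split off from all three sums. *)
rewrite /ladder (bigD1 k) // [in X in _ - X](bigD1 k) // [RHS](bigD1 k) //=.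
rewrite (bigD1 l) // [in X in _ - X](bigD1 l) // [X in _ = _ + X](bigD1 l) //=.
set F := \sum_(i | _) _; set G := \sum_(i | _) _.
(* For [m] off the bond, the excess, the rate and the exchange are all unaffected by the update, so
   these terms match one by one. *)
rewrite [X in _ = _ + (_ + X)](_ : _ = jump_rate (xi k) (xi l) * (F - G)); last first.
  rewrite -sumrB mulr_sumr; apply: eq_bigr => m /andP[mk ml].
  rewrite (excess_swap _ _ kl) // !ffunE tpermD 1?eq_sym //.
  rewrite [k == m]eq_sym [l == m]eq_sym (negPf mk) (negPf ml) swap_upd //.
  have E (c d r u v : C) : c * (d * (r * (u - v))) = r * (c * (d * u) - c * (d * v)).
    by ring.
  exact: E.
move: F G => F G; rewrite swap_updl swap_updr.
rewrite !(excess_left _ _ kl) !(excess_right _ _ kl) !(bulk_excess_swap _ _ kl).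
rewrite !ffunE tpermL tpermR !eqxx (negPf neq_kl) (negPf lk) !expfzDr //.
move: (Q ^ bulk_excess s k l xi) => c.
have rss x : jump_rate x x = 0 by rewrite /jump_rate ltnn.
apply: bond_algebra.
(* Two equal colours: the exchange is trivial and its rate is zero, while the rates after the
   updates satisfy [Qr]. *)
- move=> /eqP xs /eqP ys; have -> : swap k l xi = xi.
    by apply/ffunP => i; rewrite ffunE; case: tpermP => // ->; rewrite xs ys.
  by split; rewrite ?xs ?ys ?rss.
(* If the other colour is t, the two updated configurations coincide and both sides vanish; a third
   colour has the same rate against s as against t. *)
- move=> /eqP xs ys; have [yt|yt] := eqVneq (xi l) t; last by rewrite xs !rst.
  by rewrite upd_swapr // subrr !mulr0.
- move=> xs /eqP ys; have [xt|xt] := eqVneq (xi k) t; last by rewrite ys !rst.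
  by rewrite upd_swapl // subrr !mulr0.
Qed.

(** Interchanging the sum over [m] with the sum over bonds reduces the commutator to
    [ladder_bond]. *)
Lemma commutator_H_ladder (Q : C) s t (Y : op R n Lm Lp) : Q != 0 ->
    (forall x, x != s -> x != t ->
      (jump_rate t x = jump_rate s x) * (jump_rate x t = jump_rate x s)) ->
    Q * jump_rate t s = Q^-1 * jump_rate s t ->
    (forall f xi, act Y f xi = ladder Q s t f xi) ->
  commutator (H_ASEP n Lm Lp w q) Y = 0.
Proof.
move=> Q0 rst Qr actY; apply: commutator_eq0 => f xi.
rewrite actY act_H_ASEP /ladder.
under [RHS]eq_bigr => m _ do rewrite act_H_ASEP 2!mulr_sumr.
rewrite [RHS]exchange_big; apply: eq_bigr => k _ /=.
under [RHS]eq_bigr => m _ do rewrite 2!mulr_sumr.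
rewrite [RHS]exchange_big; apply: eq_bigr => l kl /=.
rewrite !actY (ladder_bond _ _ Q0 rst Qr kl) mulr_sumr.
by apply: eq_bigr => m _; rewrite [in RHS](mulrCA _ w%:C) (mulrCA _ w%:C).
Qed.

(** * Identification of Y^+ and Y^- with ladder sums *)

Lemma powR_Re_int (z : int) : 0 <= q ->
  (q `^ complex.Re (z%:~R : C))%:C = q%:C ^ z.
Proof.
move=> q0; have -> : z%:~R = z%:~R%:C :> C by rewrite rmorph_int.
by rewrite /= powR_intmul // fmorphXz.
Qed.

(** [B] acts last and is evaluated at [xi]; [A] acts before the update and is evaluated at the
    updated configuration. *)
Lemma act_ladder_at (A B : op R n Lm Lp) (g h : config -> int) s t k f xi :
    0 < q ->
    (forall eta, A (enum_rank eta) (enum_rank eta) = (g eta)%:~R) ->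
    (forall eta, B (enum_rank eta) (enum_rank eta) = (h eta)%:~R) ->
  act (pow_diag q A *m at_site (sigma R t s) k *m pow_diag q B) f xi
  = q%:C ^ (h xi + g (upd k t xi)) * ((xi k == s)%:R * f (upd k t xi)).
Proof.
move=> q0 AE BE; rewrite act_mulmx act_pow_diag act_mulmx act_sigma act_pow_diag.
rewrite AE BE !powR_Re_int ?ltW // mulrCA [X in _ * X = _]mulrA -expfzDr.
  by rewrite mulrCA.
by rewrite fmorph_eq0 gt_eqF.
Qed.

(** Counts strictly to one side of [k] do not see the update at [k], so both diagonal factors can be
    read off at the same configuration. *)
Lemma sum_upd_neq s t k (P : pred site) xi : ~~ P k ->
  (\sum_(l | P l) (upd k t xi l == s) = \sum_(l | P l) (xi l == s))%N.
Proof.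
move=> Pk; apply: eq_bigr => l Pl; rewrite ffunE.
by have [lk|//] := eqVneq l k; rewrite -lk Pl in Pk.
Qed.

Lemma act_Y_plus a f xi : 0 < q ->
  act (Y_plus Lm Lp q a) f xi = ladder q%:C a (inord a.-1) f xi.
Proof.
move=> q0; rewrite act_sum; apply: eq_bigr => k _.
rewrite (act_ladder_at
  (g := fun eta => - (\sum_(l | (\val l < \val k)%R) (eta l == a))%N%:Z)
  (h := fun eta => (\sum_(l | (\val k < \val l)%R) (eta l == a))%N%:Z)) //.
- by rewrite sum_upd_neq ?ltxx // excessE.
- by move=> eta; rewrite mxE sum_n_hat_diagE rmorphN.
- by move=> eta; rewrite sum_n_hat_diagE.
Qed.

Lemma act_Y_minus a f xi : 0 < q ->
  act (Y_minus Lm Lp q a) f xi = ladder q%:C^-1 (inord a.-1) a f xi.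
Proof.
move=> q0; rewrite act_sum; apply: eq_bigr => k _.
set s := inord a.-1; rewrite (act_ladder_at
  (g := fun eta => (\sum_(l | (\val l < \val k)%R) (eta l == s))%N%:Z)
  (h := fun eta => - (\sum_(l | (\val k < \val l)%R) (eta l == s))%N%:Z)) //.
(* The exponent is the negative of the excess, which the base q^-1 absorbs. *)
- by rewrite sum_upd_neq ?ltxx // exprz_inv excessE opprB addrC.
- by move=> eta; rewrite sum_n_hat_diagE.
- by move=> eta; rewrite mxE sum_n_hat_diagE rmorphN.
Qed.

Lemma jump_rate_step a : (0 < a)%N ->
  jump_rate a (inord a.-1) = q%:C /\ jump_rate (inord a.-1) a = q%:C^-1.
Proof.
move=> a0; rewrite /jump_rate /=.
have -> : (inord a.-1 : 'I_n.+1) = a.-1 :> nat.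
  by rewrite inordK // (leq_ltn_trans (leq_pred a)).
have lt_pred : (a.-1 < a)%N by rewrite prednK.
by rewrite lt_pred ltnNge ltnW.
Qed.

Lemma commutator_H_Y a : 0 < q -> (0 < a)%N ->
  commutator (H_ASEP n Lm Lp w q) (Y_plus Lm Lp q a) = 0 /\
  commutator (H_ASEP n Lm Lp w q) (Y_minus Lm Lp q a) = 0.
Proof.
move=> q0 a0; have [rab rba] := jump_rate_step a0.
have Q0 : q%:C != 0 :> C by rewrite fmorph_eq0 gt_eqF.
have pred x : x != a -> x != inord a.-1 -> _ := jump_rate_pred a0.
split.
  (* [Q] solves Q^2 = r(s, t) / r(t, s). For s = a, t = a - 1 this gives q, for the reverse pair
     q^-1; both sides of the balance condition are then 1. *)
  apply: (@commutator_H_ladder q%:C a (inord a.-1)) => //.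
    by rewrite rab rba mulfV // mulVf.
  by move=> f xi; rewrite act_Y_plus.
apply: (@commutator_H_ladder q%:C^-1 (inord a.-1) a) => //.
- by rewrite invr_eq0.
- by move=> x xb xa; split; rewrite pred.
- by rewrite rab rba invrK mulVf // mulfV.
- by move=> f xi; rewrite act_Y_minus.
Qed.

End Lattice.

Theorem proposition4p2 (R : realType) (n : nat) (Lm Lp : int) (w q : R)
    (hn : (1 <= n)%N) (hw : 0 < w) (hq : 1 <= q) (hL : 2 <= Lp - Lm + 1) :
  [/\ H_PS n Lm Lp w q =
        diag_pow (pi_hat n Lm Lp q) (- 2^-1) *m H_ASEP n Lm Lp w q
          *m diag_pow (pi_hat n Lm Lp q) 2^-1,
      forall a : 'I_n.+1,
        commutator (H_ASEP n Lm Lp w q) (N_hat R Lm Lp a) = 0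
    & forall a : 'I_n.+1, (1 <= a)%N ->
        commutator (H_ASEP n Lm Lp w q) (Y_plus Lm Lp q a) = 0 /\
        commutator (H_ASEP n Lm Lp w q) (Y_minus Lm Lp q a) = 0].
Proof.
have q0 : 0 < q := lt_le_trans ltr01 hq.
split=> [|a|a a0]; first exact: ground_state_transformation.
  exact: commutator_H_N_hat.
exact: commutator_H_Y.
Qed.
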